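(* Every stratified Lie algebra that is of type $(\Diamond)$ is semigenerated.
   Context: All Lie algebras are finite-dimensional and real. A stratified Lie algebra (Carnot algebra) of step $s\ge 1$ is a Lie algebra with a decomposition $\mathfrak g=V_1\oplus\cdots\oplus V_s$ such that $[V_1,V_j]=V_{j+1}$ for $1\le j<s$, $[V_1,V_s]=\{0\}$ and $V_s\neq\{0\}$. Let $G$ be the simply connected Lie group with Lie algebra $\mathfrak g$; $\exp:\mathfrak g\to G$ is a diffeomorphism. A horizontal half-space of $\mathfrak g$ is a set $W=\lambda^{-1}([0,+\infty))\subseteq V_1$ with $\lambda$ a non-zero element of the dual of $V_1$. A set $W\subseteq\mathfrak g$ is semigenerating if the closure of the semigroup generated by $\exp(W)$ in $G$ contains the commutator subgroup $[G,G]$. The Lie algebra $\mathfrak g$ is semigenerated if every horizontal half-space in $\mathfrak g$ is semigenerating. Type $(\Diamond)$: a stratified Lie algebra $\mathfrak g$ is of type $(\Diamond)$ if, for each subalgebra $\mathfrak h$ of $\mathfrak g$ for which $\mathfrak h\cap V_1$ has codimension $1$ in $V_1$, there exists a basis $\{X_1,\dots,X_m\}$ of $V_1$ such that $$\operatorname{ad}_{X_i}^2X_j\in\mathfrak h\quad\text{and}\quad \operatorname{ad}^2_{\operatorname{ad}_{X_i}^kX_j}(X_i)\in\mathfrak h\qquad\text{for all } i,j=1,\dots,m\text{ and all } k\ge2.$$ Here $\operatorname{ad}_XY=[X,Y]$. *)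

(* Defs.v *)
From HB Require Import structures.
From mathcomp Require Import all_boot all_order all_algebra.
From mathcomp Require Import all_classical all_reals all_analysis.

Set Implicit Arguments.
Unset Strict Implicit.
Unset Printing Implicit Defensive.

Import Order.TTheory GRing.Theory Num.Theory.
Import numFieldNormedType.Exports.
Import VectorInternalTheory.

Local Open Scope classical_set_scope.
Local Open Scope ring_scope.

HB.mixin Record Vector_isLie (R : realType) g of Vector R g := {
  lie : g -> g -> g;
  lie_linearl : forall y : g, linear (lie ^~ y);
  lie_linearr : forall x : g, linear (lie x);
  lie_alt : forall x : g, lie x x = 0;
  lie_jacobi : forall x y z : g,
    lie x (lie y z) + lie y (lie z x) + lie z (lie x y) = 0
}.

#[short(type="lieAlgType")]
HB.structure Definition LieAlgebra (R : realType) :=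
  {g of Vector_isLie R g & Vector R g}.

Section LieAlgebraDefs.
Variables (R : realType) (g : lieAlgType R).
Implicit Types (U W Z H : {vspace g}) (x y : g).

Definition ad x : g -> g := lie x.

Definition lie_subalgebra H := forall x y, x \in H -> y \in H -> lie x y \in H.

(* [U, W], the linear span of the brackets; bases suffice by bilinearity, *)
(* see lie_prodv_subP.                                                    *)
Definition lie_prodv U W : {vspace g} :=
  <<[seq lie x y | x <- vbasis U, y <- vbasis W]>>%VS.

Lemma lie_prodv_subP U W Z :
  (lie_prodv U W <= Z)%VS <->
  (forall x y, x \in U -> y \in W -> lie x y \in Z).
Proof.
split=> [/subvP sZ x y xU yW|sZ]; last first.
  apply/span_subvP => _ /allpairsP[[x y] /= [xU yW ->]].
  by apply: sZ; exact: vbasis_mem.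
have lie0l z : lie (0 : g) z = 0.
  by have := lie_linearl z (-1) (0 : g) 0; rewrite scaler0 add0r scaleN1r addNr.
have lie0r z : lie z (0 : g) = 0.
  by have := lie_linearr z (-1) (0 : g) 0; rewrite scaler0 add0r scaleN1r addNr.
rewrite (coord_vbasis xU).
apply: (big_ind (fun a => lie a y \in Z)).
- by rewrite lie0l mem0v.
- by move=> a c aZ cZ; rewrite -[a]scale1r lie_linearl scale1r memvD.
move=> i _; rewrite -[_ *: _]addr0 lie_linearl lie0l addr0 memvZ//.
rewrite (coord_vbasis yW).
apply: (big_ind (fun b => lie (vbasis U)`_i b \in Z)).
- by rewrite lie0r mem0v.
- by move=> a c aZ cZ; rewrite -[a]scale1r lie_linearr scale1r memvD.
move=> j _; rewrite -[_ *: _]addr0 lie_linearr lie0r addr0 memvZ//.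
by apply/sZ/memv_span/allpairs_f; apply: mem_nth; rewrite size_tuple.
Qed.

(* Only V 1, ..., V s matter. *)
Definition stratification (s : nat) (V : nat -> {vspace g}) :=
  [/\ (0 < s)%N,
      directv (\sum_(j < s) V j.+1) /\ (\sum_(j < s) V j.+1)%VS = fullv,
      forall j, (1 <= j < s)%N -> lie_prodv (V 1%N) (V j) = V j.+1,
      lie_prodv (V 1%N) (V s) = 0%VS
    & V s != 0%VS].

Definition type_diamond (V1 : {vspace g}) :=
  forall H, lie_subalgebra H -> (\dim (H :&: V1)).+1 = \dim V1 ->
  exists X : (\dim V1).-tuple g,
    basis_of V1 X /\
    forall i j : 'I_(\dim V1),
      let Xi := tnth X i in let Xj := tnth X j in
      iter 2 (ad Xi) Xj \in H /\
      forall k, (2 <= k)%N -> iter 2 (ad (iter k (ad Xi) Xj)) Xi \in H.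

Definition horizontal_halfspace (V1 : {vspace g}) (W : set g) :=
  exists2 l : 'Hom(subvs_of V1, R^o),
    l != 0 & W = vsval @` [set u | 0 <= (l u : R)].

End LieAlgebraDefs.

(* For maps between finite-dimensional spaces this is the usual class C^k. *)
Fixpoint Ck (R : realType) (V W : normedModType R) (k : nat) (f : V -> W) :=
  if k is k'.+1 then
    (forall x, differentiable f x) /\ forall v, Ck k' (fun x => 'D_v f x)
  else continuous f.

Definition smooth (R : realType) (V W : normedModType R) (f : V -> W) :=
  forall k, Ck k f.

#[short(type="groupTopologicalType")]
HB.structure Definition GroupTopological := {G of Group G & Topological G}.

Section LieGroup.
Variables (R : realType) (g : lieAlgType R).

(* A Lie group with a global chart log : G -> g (read in the coordinates  *)
(* v2r of g): M is its multiplication in the chart, and linv_field M y is  *)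
(* the left-invariant vector field whose value at the identity 0 is y.     *)
Definition linv_field n (M : 'rV[R]_n -> 'rV[R]_n -> 'rV[R]_n)
  (y z : 'rV[R]_n) : 'rV[R]_n := 'D_y (M z) 0.

(* Bracket at the identity of the left-invariant vector fields of x and y. *)
Definition linv_bracket n (M : 'rV[R]_n -> 'rV[R]_n -> 'rV[R]_n)
  (x y : 'rV[R]_n) : 'rV[R]_n :=
  'D_x (linv_field M y) 0 - 'D_y (linv_field M x) 0.

(* A Lie group with Lie algebra g whose exponential map is a diffeomorphism *)
(* (so it is simply connected). Its smooth structure is the one given by    *)
(* the chart log; that exp is the exponential map is expressed by           *)
(* t |-> exp (t x) being a one-parameter subgroup, whose velocity at the    *)
(* identity is x in this chart.                                             *)
Record expLieGroup := ExpLieGroup {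
  lgroup :> groupTopologicalType;
  lexp : g -> lgroup;
  llog : lgroup -> g;
  lexpK : cancel lexp llog;
  llogK : cancel llog lexp;
  lexp_continuous : continuous (fun z : 'rV[R]__ => lexp (r2v z));
  llog_continuous : continuous (fun a : lgroup => v2r (llog a));
  lmul_chart := fun z w : 'rV[R]_(dim g) =>
    v2r (llog (lexp (r2v z) * lexp (r2v w))%g);
  lmul_smooth : smooth (fun p => lmul_chart p.1 p.2);
  linvg_smooth : smooth (fun z => v2r (llog (lexp (r2v z))^-1%g));
  lexpD : forall (a b : R) (x : g),
    lexp ((a + b) *: x) = (lexp (a *: x) * lexp (b *: x))%g;
  lexp_lie : forall x y : g,
    v2r (lie x y) = linv_bracket lmul_chart (v2r x) (v2r y)
}.

End LieGroup.

Section Semigroup.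
Variable G : groupType.
Implicit Type S : set G.

Definition is_subsemigroup S := forall a b, S a -> S b -> S (a * b)%g.

Definition is_subgroup S :=
  [/\ S 1%g, is_subsemigroup S & forall a, S a -> S a^-1%g].

Definition semigroup_generated (A : set G) : set G :=
  smallest is_subsemigroup A.

Definition commutator_subgroup : set G :=
  smallest is_subgroup [set c | exists a b : G, c = commg a b].

End Semigroup.

Arguments commutator_subgroup G : clear implicits.

Definition semigenerating (R : realType) (g : lieAlgType R)
    (G : expLieGroup g) (W : set g) :=
  commutator_subgroup G `<=` closure (semigroup_generated (@lexp R g G @` W)).

(* Any two G : expLieGroup g are isomorphic (compatibly with exp), so this  *)
(* is a property of the stratified Lie algebra alone.                       *)
Definition semigenerated (R : realType) (g : lieAlgType R)
    (V1 : {vspace g}) :=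
  forall (G : expLieGroup g) W, horizontal_halfspace V1 W -> semigenerating G W.

(* Main.v *)
(* Let S be the closure of the semigroup generated by exp(W). Its tangent     *)
(* wedge w = {x : exp(tx) in S for all t >= 0} is a closed convex cone, by    *)
(* Trotter's formula, and contains the half-space W. Its edge h = w and -w    *)
(* is a Lie subalgebra, and exp(h) acts on w by the adjoint action. Hence, if *)
(* x is in w, y in h and ad_y^2 x in h, then Ad(exp(sy)) x = x + s[y, x]      *)
(* modulo h for every real s; dividing by |s| gives [y, x] in h. With the     *)
(* basis provided by type (diamond), take Y = X_i outside h: y = ad_Y^k X_j,  *)
(* x = Y for k >= 2, and y = X_j - cY in h, x = Y for k = 1, show that        *)
(* ad_Y^k X_j is in h for all k >= 1. Lazard elimination then yields          *)
(* [g, g] in h. Finally a group commutator is exp(b + n) exp(-b) with n in    *)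
(* [g, g], again a limit of Trotter products.                                 *)

From HB Require Import structures.
Require Import Defs.
From mathcomp Require Import all_boot all_order all_algebra.
From mathcomp Require Import all_classical all_reals all_analysis.
From mathcomp Require Import ring.

Set Implicit Arguments.
Unset Strict Implicit.
Unset Printing Implicit Defensive.

Import Order.TTheory GRing.Theory Num.Theory.
Import numFieldNormedType.Exports.
Import VectorInternalTheory.

Local Open Scope classical_set_scope.
Local Open Scope ring_scope.

(** * Calculus in several variables *)

(** The group is studied in its logarithmic chart, as a smooth law [M] on row vectors whose
    one-parameter subgroups are the lines [t *: z]. In this chart conjugation [chart_Ad] is linear
    ([chart_Ad_linear]) and its derivative is the bracket ([is_derive_chart_Ad0]); products are
    controlled by Trotter's formula ([cvg_chart_trotter]).

    The closure of the semigroup becomes a closed set [S] with a wedge and an edge; [wedgeD] and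
    [edge_bracket] make the edge a subalgebra. It contains the kernel of the functional, so it
    contains $V_1$ or meets it in codimension 1, and in the latter case type $(\Diamond)$ applies to
    it. The crux is [edge_bracket_wedge]: when $\operatorname{ad}_y^2x$ is in the edge, the whole
    line $x+s[y,x]$ lies in the wedge, and a closed convex cone containing a line contains both
    directions of that line. [diamond_derived_sub] applies this to the basis given by the type, and
    [derived_algebra_sub] extends the result to $[\mathfrak g,\mathfrak g]$. Finally
    [chart_commutator_mem] passes from the derived algebra to group commutators. *)

Section Calculus.
Variable R : realType.
Implicit Types (V W X : normedModType R) (s : R).

Lemma is_derive_comp_curve V W (F : V -> W) (c : R -> V) s c' :
  differentiable F (c s) -> is_derive s 1 c c' ->
  is_derive s 1 (F \o c) ('D_c' F (c s)).
Proof.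
move=> dF [/derivable1_diffP dc <-].
have dFc : differentiable (F \o c) s by exact: differentiable_comp.
split; first exact/derivable1_diffP.
by rewrite deriveE// diff_comp//= deriveE// deriveE.
Qed.

Lemma is_derive_pair V W (c : R -> V) (d : R -> W) s c' d' :
  is_derive s 1 c c' -> is_derive s 1 d d' ->
  is_derive s 1 (fun t => (c t, d t)) (c', d').
Proof.
move=> [/derivable1_diffP dc <-] [/derivable1_diffP dd <-].
have dcd := differentiable_pair dc dd.
split; first exact/derivable1_diffP.
by rewrite deriveE// diff_pair// !deriveE.
Qed.

Lemma is_derive_scale V (v : V) s : is_derive s 1 (fun t : R => t *: v) v.
Proof.
have dl := is_diff_scalel s v.
split; first exact/derivable1_diffP/ex_diff.
by rewrite deriveE ?diff_val ?scale1r//; exact: ex_diff.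
Qed.

Lemma is_derive_line V (p v : V) s : is_derive s 1 (fun t : R => p + t *: v) v.
Proof.
rewrite -[X in is_derive _ _ _ X]add0r.
exact: (is_deriveD (is_derive_cst p s 1) (is_derive_scale v s)).
Qed.

Lemma derive_dirD V W (F : V -> W) p u v : differentiable F p ->
  'D_(u + v) F p = 'D_u F p + 'D_v F p.
Proof. by move=> dF; rewrite !deriveE// linearD. Qed.

Lemma is_derive_shift0 V (c : R -> V) s c' :
  is_derive (0 : R) 1 (fun h => c (s + h)) c' -> is_derive s 1 c c'.
Proof.
move=> [dc <-].
have e : (fun h : R => h^-1 *: ((c \o shift s) (h *: 1) - c s))
  = (fun h : R => h^-1 *: (((fun h => c (s + h)) \o shift 0) (h *: 1)
                         - c (s + 0))).
  by apply/funext => h /=; rewrite !addr0 (addrC s).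
by split; rewrite /derivable /derive e.
Qed.

Lemma cvg_derive_curve V (c : R -> V) c' : is_derive (0 : R) 1 c c' ->
  (fun h => h^-1 *: (c h - c 0)) @ 0^' --> c'.
Proof.
move=> [dc <-]; have := dc; rewrite /derivable /derive.
under eq_fun do rewrite /= addr0 [_ *: 1]mulr1.
exact.
Qed.

Lemma is_derive_cvg V (c : R -> V) c' :
  (fun h => h^-1 *: (c h - c 0)) @ 0^' --> c' -> is_derive (0 : R) 1 c c'.
Proof.
move=> h.
have e : (fun h : R => h^-1 *: (c h - c 0))
  = (fun h : R => h^-1 *: ((c \o shift 0) (h *: 1) - c 0)).
  by apply/funext => k /=; rewrite addr0 [_ *: 1]mulr1.
rewrite e in h; split; last exact/cvg_lim.
by apply/cvg_ex; exists c'.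
Qed.

Lemma cvg_invn_dnbhs : (fun k : nat => k.+1%:R^-1 : R) @ \oo --> (0 : R)^'.
Proof.
move=> A /= [e /= e0 eA].
have /cvgrPdist_lt/(_ _ e0) := @cvg_harmonic R.
apply: filterS => k /= ke; apply: eA; first exact: ke.
by rewrite invr_neq0// pnatr_eq0.
Qed.

Lemma cvg_derive_seq V (c : R -> V) c' : c 0 = 0 -> is_derive (0 : R) 1 c c' ->
  (fun k => k.+1%:R *: c (k.+1%:R^-1)) @ \oo --> c'.
Proof.
move=> c0 /cvg_derive_curve /(cvg_comp _ _ cvg_invn_dnbhs).
by apply: cvg_trans; apply: near_eq_cvg; apply: nearW => k /=;
  rewrite c0 subr0 invrK.
Qed.

Lemma is_deriveZ_curve V (a : R -> R) (c : R -> V) a' c' :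
  is_derive (0 : R) 1 a a' -> is_derive (0 : R) 1 c c' ->
  is_derive (0 : R) 1 (fun t => a t *: c t) (a' *: c 0 + a 0 *: c').
Proof.
move=> da dc; apply: is_derive_cvg.
have cc : c h @[h --> 0^'] --> c 0.
  have /derivable1_diffP/differentiable_continuous cc := @ex_derive _ _ _ _ _ _ _ dc.
  exact: cvg_within_filter cc.
have h1 := cvgZ (cvg_derive_curve da) cc.
have h2 := cvgZl_tmp (k := a 0) (cvg_derive_curve dc).
apply: cvg_trans (cvgD (h1 _) (h2 _)).
apply: near_eq_cvg; apply: nearW => h /=.
rewrite -[LHS]/((h^-1 * (a h - a 0)) *: c h + a 0 *: (h^-1 *: (c h - c 0))).
rewrite -scalerA [a 0 *: _]scalerA mulrC -scalerA -scalerDr.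
by rewrite scalerBl scalerBr addrA subrK.
Qed.

Lemma smooth_differentiable V W (f : V -> W) p : smooth f -> differentiable f p.
Proof. by move=> /(_ 1%N) [+ _]; exact. Qed.

Lemma smooth_derive V W (f : V -> W) v : smooth f -> smooth ('D_v f).
Proof. by move=> fs k; have [_] := fs k.+1; exact. Qed.

(** * Symmetry of mixed second derivatives *)

(** Two applications of the mean value theorem: first along [v] to the difference of [f] on two
    parallel segments, then along [u] to ['D_v f]. *)
Lemma second_differenceE V (f : V -> R) u v p s :
  (forall q, differentiable f q) -> (forall q, differentiable ('D_v f) q) ->
  0 < s -> exists ab : R * R, [/\ 0 <= ab.1 <= s, 0 <= ab.2 <= s &
  f (p + s *: u + s *: v) - f (p + s *: v) - (f (p + s *: u) - f p)
  = s ^+ 2 * 'D_u ('D_v f) (p + ab.1 *: u + ab.2 *: v)].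
Proof.
move=> df dg s0.
have dline (F : V -> R) q w (t : R) : (forall q, differentiable F q) ->
    is_derive t 1 (fun t => F (q + t *: w)) ('D_w F (q + t *: w)).
  by move=> dF; apply: is_derive_comp_curve (is_derive_line q w t).
have cline (F : R -> R) F' : (forall t : R, is_derive t 1 F (F' t)) ->
    {within `[0, s], continuous F}.
  move=> dF; apply/continuous_subspaceT => t.
  exact/differentiable_continuous/derivable1_diffP/(@ex_derive _ _ _ _ _ _ _ (dF t)).
pose phi t := f (p + s *: u + t *: v) - f (p + t *: v).
have dphi t := is_deriveB (dline f (p + s *: u) v t df) (dline f p v t df).
have [b + eb] := MVT s0 (fun t _ => dphi t) (cline _ _ dphi).
rewrite in_itv/= => /andP[b0 bs].
have dpsi t := dline ('D_v f) (p + b *: v) u t dg.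
have [a + ea] := MVT s0 (fun t _ => dpsi t) (cline _ _ dpsi).
rewrite in_itv/= => /andP[a0 as_].
exists (a, b); split; rewrite /= ?(ltW a0) ?(ltW b0) ?ltW//.
move: eb ea; rewrite !fctE/= !scale0r !addr0 subr0 => -> ea.
rewrite expr2 -mulrA mulrC; congr (_ * _); rewrite mulrC.
by rewrite (addrAC p (a *: u)) -ea (addrAC p).
Qed.

(** The second difference is symmetric in [u] and [v]; divided by [s k ^+ 2] it tends, by
    continuity, to either mixed derivative. *)
Lemma mixed_derivativesC_scalar V (f : V -> R) u v p :
  (forall q, differentiable f q) ->
  (forall w q, differentiable ('D_w f) q) ->
  (forall w w', continuous ('D_w ('D_w' f))) ->
  'D_u ('D_v f) p = 'D_v ('D_u f) p.
Proof.
move=> df dg ch.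
pose s k : R := k.+1%:R^-1.
have s0 k : 0 < s k by rewrite invr_gt0.
have scvg : s @ \oo --> 0 by exact: cvg_harmonic.
pose Q w w' k := (s k ^+ 2)^-1 * (f (p + s k *: w + s k *: w')
   - f (p + s k *: w') - (f (p + s k *: w) - f p)).
have QC : Q u v = Q v u.
  apply/funext => k; rewrite /Q; congr (_ * _).
  by rewrite (addrAC p); ring.
have Qcvg w w' : Q w w' @ \oo --> 'D_w ('D_w' f) p.
  have /choice[ab hab] k := second_differenceE w p df (dg w') (s0 k).
  have -> : Q w w' = (fun k => 'D_w ('D_w' f)
               (p + (ab k).1 *: w + (ab k).2 *: w')).
    apply/funext => k; rewrite /Q; have [_ _ ->] := hab k.
    by rewrite mulKf// expf_neq0// gt_eqF.
  have sq (x : nat -> R) : (forall k, 0 <= x k <= s k) -> x @ \oo --> 0.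
    move=> hx; apply: (squeeze_cvgr _ (cvg_cst 0) scvg).
    exact: nearW.
  have pcvg : (p + (ab k).1 *: w + (ab k).2 *: w') @[k --> \oo] --> p.
    suff: (p + (ab k).1 *: w + (ab k).2 *: w') @[k --> \oo]
        --> p + 0 *: w + 0 *: w' by rewrite !scale0r !addr0.
    apply: cvgD; first apply: cvgD; first exact: (cvg_cst p).
      by apply: cvgZr_tmp (sq _ _) => k; have [] := hab k.
    by apply: cvgZr_tmp (sq _ _) => k; have [] := hab k.
  exact: (cvg_comp _ _ pcvg (ch w w' p)).
have cu := Qcvg u v; have cv := Qcvg v u; rewrite -QC in cv.
exact: cvg_unique cu cv.
Qed.

Lemma mixed_derivativesC V n (f : V -> 'rV[R]_n) u v p :
  smooth f -> 'D_u ('D_v f) p = 'D_v ('D_u f) p.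
Proof.
move=> fs; apply/rowP => j; pose co (F : V -> 'rV[R]_n) : V -> R := fun q => F q 0 j.
have coE F w : smooth F -> 'D_w (co F) = co ('D_w F).
  move=> Fs; apply/funext => q; rewrite [RHS]/co [in RHS]derive_mx ?mxE//.
  exact/diff_derivable/smooth_differentiable.
have dco F q : smooth F -> differentiable (co F) q.
  move=> Fs; apply: (@differentiable_comp _ _ _ _ F (fun M => M 0 j)).
    exact: smooth_differentiable.
  exact: differentiable_coord.
have fD w := smooth_derive w fs.
have eD w w' : 'D_w ('D_w' (co f)) = co ('D_w ('D_w' f)) by rewrite (coE f)// coE.
rewrite -[LHS](congr1 (@^~ p) (eD u v)) -[RHS](congr1 (@^~ p) (eD v u)).
apply: mixed_derivativesC_scalar => [q|w q|w w' q]; first exact: dco.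
  by rewrite coE//; exact: dco.
by rewrite eD; apply/differentiable_continuous/dco/smooth_derive.
Qed.

(** * Partial derivatives, coordinates and linear maps *)

Lemma derive_pairl V W X (F : V * W -> X) u p q :
  'D_u (fun z => F (z, q)) p = 'D_(u, 0) F (p, q).
Proof.
rewrite [LHS]/derive [RHS]/derive.
have -> // : (fun h : R => h^-1 *: (((fun z => F (z, q)) \o shift p) (h *: u)
    - F (p, q))) = (fun h => h^-1 *: ((F \o shift (p, q)) (h *: (u, 0))
    - F (p, q))).
apply/funext => h /=.
by rewrite -[h *: (u, 0) + _]/(h *: u + p, h *: 0 + q) scaler0 add0r.
Qed.

Lemma derive_pairr V W X (F : V * W -> X) v p q :
  'D_v (fun z => F (p, z)) q = 'D_(0, v) F (p, q).
Proof.
rewrite [LHS]/derive [RHS]/derive.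
have -> // : (fun h : R => h^-1 *: (((fun z => F (p, z)) \o shift q) (h *: v)
    - F (p, q))) = (fun h => h^-1 *: ((F \o shift (p, q)) (h *: (0, v))
    - F (p, q))).
apply/funext => h /=.
by rewrite -[h *: (0, v) + _]/(h *: 0 + p, h *: v + q) scaler0 add0r.
Qed.

Lemma is_derive_coord n (c : R -> 'rV[R]_n) (c' : 'rV[R]_n) s j :
  is_derive s 1 c c' -> is_derive s 1 (fun t => c t 0 j) (c' 0 j).
Proof.
move=> [dc <-]; split; first by have /derivable_mxP := dc; exact.
by rewrite [in RHS]derive_mx// mxE.
Qed.

Lemma is_derive_bigsum V n (F : 'I_n -> R -> V) (F' : 'I_n -> V) s :
  (forall i, is_derive s 1 (F i) (F' i)) ->
  is_derive s 1 (fun t => \sum_i F i t) (\sum_i F' i).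
Proof. by move=> dF; have := is_derive_sum dF; rewrite fct_sumE. Qed.

Lemma linear_rowE (V : lmodType R) n (G : 'rV[R]_n -> V) : linear G ->
  forall w, G w = \sum_i w 0 i *: G (delta_mx 0 i).
Proof.
move=> Gl w; pose GL : {linear 'rV[R]_n -> V} :=
  HB.pack G (GRing.isLinear.Build _ _ _ _ G Gl).
rewrite -[G]/(GL : _ -> _) {1}(row_sum_delta w) linear_sum.
by apply: eq_bigr => i _; rewrite linearZ.
Qed.

Lemma derive_linear V W (G : V -> W) : linear G -> continuous G ->
  forall p v, 'D_v G p = G v.
Proof.
move=> Gl Gc p v; pose GL : {linear V -> W} :=
  HB.pack G (GRing.isLinear.Build _ _ _ _ G Gl).
rewrite -[G]/(GL : _ -> _) deriveE ?diff_lin//.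
exact: linear_differentiable.
Qed.

End Calculus.

(** * Group law in the exponential chart *)

(* The group law of an exponential Lie group, read through [log]. *)
Record exp_chart (R : realType) n (M : 'rV[R]_n -> 'rV[R]_n -> 'rV[R]_n) : Prop :=
  ExpChart {
    chart_smooth : smooth (fun p : 'rV[R]_n * 'rV[R]_n => M p.1 p.2);
    chart_mulA : associative M;
    chart_mul0l : left_id 0 M;
    chart_mulZ : forall (a b : R) (z : 'rV[R]_n),
      M (a *: z) (b *: z) = (a + b) *: z
  }.

Section ExponentialChart.
Variables (R : realType) (n : nat).
Local Notation E := 'rV[R]_n.
Variable M : E -> E -> E.
Hypothesis hM : exp_chart M.
Let f (p : E * E) : E := M p.1 p.2.
Let Ms := chart_smooth hM.
Let MA := chart_mulA hM.
Let M0z := chart_mul0l hM.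
Let MD := chart_mulZ hM.

Let Mz0 : right_id 0 M.
Proof. by move=> z; have := MD 1 0 z; rewrite scale0r scale1r addr0 scale1r. Qed.

Let fD p : differentiable f p. Proof. exact: smooth_differentiable Ms. Qed.
Let fDD v p : differentiable ('D_v f) p.
Proof. exact/smooth_differentiable/smooth_derive. Qed.

Implicit Types (x y z w : E) (s t : R).

Lemma chart_mulN z : M z (- z) = 0.
Proof. by have := MD 1 (- 1) z; rewrite scaleN1r scale1r subrr scale0r. Qed.

Lemma chart_Nmul z : M (- z) z = 0.
Proof. by have := MD (- 1) 1 z; rewrite scaleN1r scale1r addNr scale0r. Qed.

Lemma chart_pow k z : iter k (M z) 0 = k%:R *: z.
Proof.
elim: k => [|k IH]; first by rewrite scale0r.
by rewrite iterS IH -{1}[z]scale1r MD -natr1 addrC.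
Qed.

Lemma is_derive_chart_mul (c d : R -> E) c' d' (s : R) :
  is_derive s 1 c c' -> is_derive s 1 d d' ->
  is_derive s 1 (fun t => M (c t) (d t))
    ('D_(c', 0) f (c s, d s) + 'D_(0, d') f (c s, d s)).
Proof.
move=> dc dd.
have e : (c', d') = (c', 0) + (0, d') :> E * E.
  by rewrite -[RHS]/(c' + 0, 0 + d') addr0 add0r.
rewrite -(derive_dirD _ _ (fD _)) -e.
exact: is_derive_comp_curve (fD _) (is_derive_pair dc dd).
Qed.

Lemma derive_chart_mul_r0 x z : 'D_(x, 0) f (z, 0) = x.
Proof.
have d0 : is_derive (0 : R) 1 (fun=> 0 : E) 0 by exact: is_derive_cst.
have := @derive_val _ _ _ _ _ _ _
  (is_derive_chart_mul (is_derive_line z x (0 : R)) d0).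
rewrite scale0r addr0 (derive0 f) addr0 => <-.
under eq_fun do rewrite Mz0; exact: (@derive_val _ _ _ _ _ _ _ (is_derive_line z x (0 : R))).
Qed.

Lemma derive_chart_mul_l0 y z : 'D_(0, y) f (0, z) = y.
Proof.
have d0 : is_derive (0 : R) 1 (fun=> 0 : E) 0 by exact: is_derive_cst.
have := @derive_val _ _ _ _ _ _ _
  (is_derive_chart_mul d0 (is_derive_line z y (0 : R))).
rewrite scale0r addr0 (derive0 f) add0r => <-.
under eq_fun do rewrite M0z; exact: (@derive_val _ _ _ _ _ _ _ (is_derive_line z y (0 : R))).
Qed.

Lemma linv_fieldE y z : linv_field M y z = 'D_(0, y) f (z, 0).
Proof. by rewrite /linv_field -derive_pairr. Qed.

Lemma linv_bracketE x y : linv_bracket M x y =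
  'D_(x, 0) ('D_(0, y) f) (0, 0) - 'D_(y, 0) ('D_(0, x) f) (0, 0).
Proof.
have H u v : 'D_u (linv_field M v) 0 = 'D_(u, 0) ('D_(0, v) f) (0, 0).
  have -> : linv_field M v = fun z => 'D_(0, v) f (z, 0).
    by apply/funext => z; exact: linv_fieldE.
  exact: (derive_pairl ('D_(0, v) f) u 0 0).
by rewrite /linv_bracket !H.
Qed.

(** Trotter's product formula: by [chart_pow], multiplying by [k.+1] is taking the [k.+1]-st power.
    The limit is the velocity at 0 of [M (t *: x) (t *: y)]. *)
Lemma cvg_chart_trotter x y :
  (fun k => k.+1%:R *: M (k.+1%:R^-1 *: x) (k.+1%:R^-1 *: y)) @ \oo --> x + y.
Proof.
have := is_derive_chart_mul (is_derive_scale x (0 : R))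
                            (is_derive_scale y (0 : R)).
rewrite !scale0r derive_chart_mul_r0 derive_chart_mul_l0.
move/cvg_derive_seq => /=; apply.
by rewrite !scale0r M0z.
Qed.

Lemma chart_mul_differentiabler x y : differentiable (M x) y.
Proof.
rewrite (_ : M x = f \o (fun y => (x, y))); last exact/funext.
by apply: differentiable_comp; [exact: differentiable_pair|exact: fD].
Qed.

Lemma chart_mul_differentiablel x y : differentiable (M ^~ y) x.
Proof.
rewrite (_ : M ^~ y = f \o (fun x => (x, y))); last exact/funext.
by apply: differentiable_comp; [exact: differentiable_pair|exact: fD].
Qed.

(* Conjugation by [exp x] in the chart; it turns out to be linear, hence    *)
(* equal to its differential [Ad (exp x)].                                  *)
Definition chart_Ad x y := M (M x y) (- x).

Lemma chart_Ad0 y : chart_Ad 0 y = y.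
Proof. by rewrite /chart_Ad M0z oppr0 Mz0. Qed.

Lemma chart_Ad_0 x : chart_Ad x 0 = 0.
Proof. by rewrite /chart_Ad Mz0 chart_mulN. Qed.

Lemma chart_mulK x z : M (- x) (M x z) = z.
Proof. by rewrite MA chart_Nmul M0z. Qed.

Lemma chart_Ad_mul x y z : chart_Ad x (M y z) = M (chart_Ad x y) (chart_Ad x z).
Proof. by rewrite /chart_Ad -!MA chart_mulK. Qed.

Lemma chart_mul_Ad x y : M (chart_Ad x y) x = M x y.
Proof. by rewrite /chart_Ad -!MA chart_Nmul Mz0. Qed.

Lemma chart_inv_unique x y : M x y = 0 -> y = - x.
Proof. by move=> xy; rewrite -(chart_mulK x y) xy Mz0. Qed.

Lemma chart_opp_mul x y : - M x y = M (- y) (- x).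
Proof.
apply/esym/chart_inv_unique.
by rewrite -MA (MA y) chart_mulN M0z chart_mulN.
Qed.

Lemma chart_Ad_comp x y z : chart_Ad (M x y) z = chart_Ad x (chart_Ad y z).
Proof. by rewrite /chart_Ad chart_opp_mul !MA. Qed.

Lemma chart_AdDl x s t z :
  chart_Ad ((s + t) *: x) z = chart_Ad (s *: x) (chart_Ad (t *: x) z).
Proof. by rewrite -MD chart_Ad_comp. Qed.

Lemma chart_Ad_natmul x y k : chart_Ad x (k%:R *: y) = k%:R *: chart_Ad x y.
Proof.
rewrite -!chart_pow; elim: k => [|k IH]; first exact: chart_Ad_0.
by rewrite !iterS chart_Ad_mul IH.
Qed.

Lemma is_derive_chart_Ad_curve (c d : R -> E) c' d' (s : R) :
  is_derive s 1 c c' -> is_derive s 1 d d' ->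
  derivable (fun t => chart_Ad (c t) (d t)) s 1.
Proof.
move=> dc dd; have dN := is_deriveN dc.
exact: (@ex_derive _ _ _ _ _ _ _
         (is_derive_chart_mul (is_derive_chart_mul dc dd) dN)).
Qed.

Lemma chart_Ad_differentiable x y : differentiable (chart_Ad x) y.
Proof.
rewrite (_ : chart_Ad x = f \o (fun y => (M x y, - x))); last exact/funext.
apply: differentiable_comp; last exact: fD.
apply: differentiable_pair; last exact: differentiable_cst.
exact: chart_mul_differentiabler.
Qed.

(** Conjugation commutes with natural multiples, so the difference quotients along the steps
    [k.+1%:R^-1] are constant. Being its own differential at 0, it is linear. *)
Lemma derive_chart_Ad0 x y : 'D_y (chart_Ad x) 0 = chart_Ad x y.
Proof.
have := is_derive_comp_curve (chart_Ad_differentiable x (0 *: y))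
          (is_derive_scale y (0 : R)).
rewrite scale0r => /cvg_derive_seq/=; rewrite scale0r chart_Ad_0 => /(_ erefl).
under eq_fun do rewrite -chart_Ad_natmul scalerA divff ?pnatr_eq0// scale1r.
by move=> /(cvg_unique _); apply => //; exact: cvg_cst.
Qed.

Lemma chart_Ad_linear x : linear (chart_Ad x).
Proof.
move=> a y z; rewrite -!derive_chart_Ad0 !deriveE ?linearP//;
  exact: chart_Ad_differentiable.
Qed.

(** Differentiate $e^{sx}e^{ty}=e^{t\operatorname{Ad}(e^{sx})y}e^{sx}$ in $t$ at 0. *)
Lemma derive_chart_mul_Ad x y s :
  'D_(0, y) f (s *: x, 0) = 'D_(chart_Ad (s *: x) y, 0) f (0, s *: x).
Proof.
have d0 : is_derive (0 : R) 1 (fun=> s *: x) 0 by exact: is_derive_cst.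
have := @derive_val _ _ _ _ _ _ _
  (is_derive_chart_mul d0 (is_derive_scale y (0 : R))).
have := @derive_val _ _ _ _ _ _ _
  (is_derive_chart_mul (is_derive_scale (chart_Ad (s *: x) y) (0 : R)) d0).
rewrite !scale0r (derive0 f) addr0 (derive0 f) add0r => <- <-.
have -> // : (fun t => M (s *: x) (t *: y))
  = (fun t => M (t *: chart_Ad (s *: x) y) (s *: x)).
apply/funext => t; rewrite -(chart_mul_Ad (s *: x)).
by have := chart_Ad_linear (s *: x) t y 0; rewrite chart_Ad_0 !addr0 => ->.
Qed.

(* Differentiate [derive_chart_mul_Ad] in [s] at [0]: the product rule for   *)
(* its right-hand side produces the second term of the bracket because      *)
(* mixed derivatives commute.                                               *)
Lemma is_derive_chart_Ad0 x y :
  is_derive (0 : R) 1 (fun s => chart_Ad (s *: x) y) (linv_bracket M x y).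
Proof.
have c0 (z : E) : is_derive (0 : R) 1 (fun=> z) 0 by exact: is_derive_cst.
have dx := is_derive_scale x (0 : R).
have dA := is_derive_chart_Ad_curve dx (c0 y).
apply: DeriveDef => //; set D := 'D_1 (fun s : R => chart_Ad (s *: x) y) (0 : R).
have {}dA : is_derive (0 : R) 1 (fun s => chart_Ad (s *: x) y) D by split.
have linD (F : E * E -> E) p : differentiable F p ->
    linear (fun w => 'D_(w, 0) F p).
  move=> dF a u v; rewrite !deriveE// -linearP; congr ('d F p _).
  by rewrite -[RHS]/(a *: u + v, a *: 0 + 0) scaler0 addr0.
(* Expanding the moving direction [chart_Ad (t *: x) y] in coordinates turns the derivative into a
   sum of scalar times vector curves, to which the product rule applies. *)
pose S (t : R) := \sum_i (chart_Ad (t *: x) y) 0 i *: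
  'D_(delta_mx 0 i, 0) f (0, t *: x).
have lhs : is_derive (0 : R) 1 S ('D_(x, 0) ('D_(0, y) f) (0 *: x, 0)).
  have <- : (fun t : R => 'D_(0, y) f (t *: x, 0)) = S.
    apply/funext => t; rewrite derive_chart_mul_Ad.
    exact: (linear_rowE (linD f (0, t *: x) (fD _))).
  exact: is_derive_comp_curve (fDD (0, y) (0 *: x, 0))
           (is_derive_pair dx (c0 0)).
have rhs i := is_deriveZ_curve (is_derive_coord i dA)
  (is_derive_comp_curve (fDD (delta_mx 0 i, 0) (0, 0 *: x))
    (is_derive_pair (c0 0) dx)).
have {}rhs := @derive_val _ _ _ _ _ _ _ (is_derive_bigsum rhs).
have {}lhs := @derive_val _ _ _ _ _ _ _ lhs.
have := etrans (esym lhs) rhs; rewrite scale0r chart_Ad0 => {lhs rhs} H.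
rewrite linv_bracketE (etrans H (big_split _ _ _ _ _))/=.
under eq_bigr do rewrite scale0r derive_chart_mul_r0.
rewrite -row_sum_delta.
have C i : 'D_(0, x) ('D_(delta_mx 0 i, 0) f) (0, 0)
    = 'D_(delta_mx 0 i, 0) ('D_(0, x) f) (0, 0) by exact: mixed_derivativesC.
under eq_bigr do rewrite C.
rewrite -(linear_rowE (linD ('D_(0, x) f) (0, 0) (fDD _ _))).
by rewrite addrK.
Qed.

(** The increment of [s] is split off on the left here and on the right in [is_derive_chart_Adr].
    This form exhibits the velocity as a bracket; the other one exhibits it as a conjugate of a
    fixed bracket. *)
Lemma is_derive_chart_Adl x y s :
  is_derive s 1 (fun s => chart_Ad (s *: x) y)
    (linv_bracket M x (chart_Ad (s *: x) y)).
Proof.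
apply: is_derive_shift0; under eq_fun do rewrite addrC chart_AdDl.
exact: is_derive_chart_Ad0.
Qed.

Lemma is_derive_chart_Adr x y s :
  is_derive s 1 (fun s => chart_Ad (s *: x) y)
    (chart_Ad (s *: x) (linv_bracket M x y)).
Proof.
apply: is_derive_shift0; under eq_fun do rewrite chart_AdDl.
have := is_derive_comp_curve (chart_Ad_differentiable (s *: x) _)
          (is_derive_chart_Ad0 x y).
rewrite derive_linear//; first exact: chart_Ad_linear.
move=> q; exact/differentiable_continuous/chart_Ad_differentiable.
Qed.

End ExponentialChart.

(** * Stratified Lie algebras of diamond type *)

(** Take a subspace of maximal dimension inside [P]; a further element of [P] would enlarge it. *)
Lemma predicate_vspace (K : fieldType) (vT : vectType K) (P : vT -> Prop) :
  P 0 -> (forall a x y, P x -> P y -> P (a *: x + y)) ->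
  exists U : {vspace vT}, forall x, x \in U <-> P x.
Proof.
move=> P0 Plin.
pose Q k := `[< exists U : {vspace vT}, \dim U = k /\ forall x, x \in U -> P x >].
have exQ : exists k, Q k.
  by exists 0%N; apply/asboolP; exists 0%VS; rewrite dimv0; split=> // x /[!memv0] /eqP->.
have ubQ k : Q k -> (k <= \dim {:vT})%N.
  by move=> /asboolP[U [<- _]]; exact: dimvS (subvf U).
case: (ex_maxnP exQ ubQ) => k /asboolP[U [dU UP]] maxk.
exists U => x; split; first exact: UP.
move=> Px; apply: contraT => xU.
suff /maxk : Q k.+1 by rewrite ltnn.
apply/asboolP; exists (U + <[x]>)%VS; split.
  have x0 : x != 0 by apply: contraNneq xU => ->; rewrite mem0v.
  rewrite dimv_disjoint_sum; first by rewrite dim_vline dU x0 addn1.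
  apply/eqP; rewrite -subv0; apply/subvP => y; rewrite memv_cap => /andP[yU].
  move=> /vlineP[a ya]; rewrite memv0; have [a0|a0] := eqVneq a 0.
    by rewrite ya a0 scale0r.
  by case/negP: xU; rewrite -(scalerK a0 x) -ya memvZ.
move=> _ /memv_addP[y yU [_ /vlineP[a ->] ->]].
by rewrite addrC; apply: Plin => //; exact: UP.
Qed.

Section LieAlgebra.
Variables (R : realType) (g : lieAlgType R).
Implicit Types (x y z : g) (H : {vspace g}).

Lemma lieDl x y z : lie (x + y) z = lie x z + lie y z.
Proof. by have := lie_linearl z 1 x y; rewrite !scale1r. Qed.

Lemma lieDr x y z : lie x (y + z) = lie x y + lie x z.
Proof. by have := lie_linearr x 1 y z; rewrite !scale1r. Qed.

Lemma lie0l x : lie 0 x = 0.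
Proof. by apply: (addrI (lie 0 x)); rewrite -lieDl !addr0. Qed.

Lemma lie0r x : lie x 0 = 0.
Proof. by apply: (addrI (lie x 0)); rewrite -lieDr !addr0. Qed.

Lemma lieZl a x y : lie (a *: x) y = a *: lie x y.
Proof. by have := lie_linearl y a x 0; rewrite lie0l !addr0. Qed.

Lemma lieZr a x y : lie x (a *: y) = a *: lie x y.
Proof. by have := lie_linearr x a y 0; rewrite lie0r !addr0. Qed.

Lemma lieNl x y : lie (- x) y = - lie x y.
Proof. by rewrite -scaleN1r lieZl scaleN1r. Qed.

Lemma lieNr x y : lie x (- y) = - lie x y.
Proof. by rewrite -scaleN1r lieZr scaleN1r. Qed.

Lemma lieC x y : lie x y = - lie y x.
Proof.
apply/eqP; rewrite -addr_eq0; apply/eqP.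
by have := lie_alt (x + y); rewrite lieDl !lieDr !lie_alt addr0 add0r.
Qed.

Lemma lie_leibniz x y z : lie x (lie y z) = lie (lie x y) z + lie y (lie x z).
Proof.
rewrite (lieC (lie x y)) (lieC x z) lieNr -opprD; apply/eqP.
by rewrite -addr_eq0 (addrC (lie z _)) addrA lie_jacobi.
Qed.

Lemma mem_lie_prodv (U W : {vspace g}) x y :
  x \in U -> y \in W -> lie x y \in lie_prodv U W.
Proof. by move: x y; apply/lie_prodv_subP. Qed.

(* Lazard elimination: the largest [ad Y]-stable subspace of [H] is a       *)
(* subalgebra that, together with [Y], spans [g].                           *)
Lemma derived_algebra_sub s (V : nat -> {vspace g}) H Y :
  stratification s V -> lie_subalgebra H -> Y \in V 1%N ->
  (V 1 <= <[Y]> + H :&: V 1)%VS ->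
  (forall k z, z \in H -> z \in V 1%N -> iter k (ad Y) z \in H) ->
  (lie_prodv fullv fullv <= H)%VS.
Proof.
move=> [s0 [_ Vfull] Vlie _ _] Hlie YV sV adY.
have iterlin k a x y : iter k (ad Y) (a *: x + y)
    = a *: iter k (ad Y) x + iter k (ad Y) y.
  by elim: k => // k IH; rewrite !iterS IH /ad lieDr lieZr.
have [J JE] : exists J : {vspace g}, forall x, x \in J <->
    forall k, iter k (ad Y) x \in H.
  apply: predicate_vspace => [k|a x y xH yH k].
    by elim: k => [|k IH]; rewrite ?mem0v// iterSr /ad lie0r.
  by rewrite iterlin memvD// memvZ.
have JH x : x \in J -> x \in H by move=> /JE/(_ 0%N).
have JY x : x \in J -> lie Y x \in J.
  by move=> /JE xJ; apply/JE => k; rewrite -[lie Y x]/(ad Y x) -iterSr.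
(* [ad Y] is a derivation, so induction on [k], for all [x] and [y] at once, moves each [ad Y] onto
   one of the factors. *)
have Jlie x y : x \in J -> y \in J -> lie x y \in J.
  move=> xJ yJ; apply/JE => k; elim: k x y xJ yJ => [|k IH] x y xJ yJ.
    by apply: Hlie; exact: JH.
  rewrite iterSr -[ad Y _]/(lie Y (lie x y)) lie_leibniz.
  by rewrite -[lie (lie Y x) y]scale1r iterlin scale1r memvD ?IH ?JY.
have V1E x : x \in V 1%N -> exists a z, z \in J /\ x = a *: Y + z.
  move=> /(subvP sV)/memv_addP[_ /vlineP[a ->] [z]].
  rewrite memv_cap => /andP[zH zV] ->; exists a, z; split => //.
  by apply/JE => k; exact: adY.
have V1J x y : x \in V 1%N -> y \in J -> lie x y \in J.
  move=> /V1E[a [z [zJ ->]]] yJ.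
  by rewrite lieDl lieZl memvD ?memvZ ?JY// Jlie.
(* Brackets in [V 1] lose their [Y] component because $[Y,Y]=0$; above degree 2, bracketing with
   [V 1] preserves [J]. *)
have VJ k : (1 <= k)%N -> (k < s)%N -> (V k.+1 <= J)%VS.
  elim: k => // -[_ _ s1|k IH _ ks]; last first.
    rewrite -Vlie//; apply/lie_prodv_subP => x y xV yV.
    by apply: V1J => //; apply: subvP yV; apply: IH => //; exact: ltnW.
  rewrite -Vlie//; apply/lie_prodv_subP => x y xV /V1E[b [z [zJ ->]]].
  rewrite lieDr lieZr memvD ?V1J// memvZ//.
  move: xV => /V1E[a [t [tJ ->]]].
  by rewrite lieDl lieZl lie_alt scaler0 add0r lieC memvN JY.
have gE x : exists a z, z \in J /\ x = a *: Y + z.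
  suff /subvP/(_ x (memvf x)) : ({:g} <= <[Y]> + J)%VS.
    by move=> /memv_addP[_ /vlineP[a ->] [z zJ ->]]; exists a, z.
  rewrite -Vfull; apply/subv_sumP => -[[|k] ks] _ /=.
    apply/subvP => y /V1E[a [z [zJ ->]]].
    by apply: memv_add => //; apply/vlineP; exists a.
  by apply: subv_trans (addvSr _ _); exact: VJ.
apply/lie_prodv_subP => x y _ _; apply: JH.
have [a [z [zJ ->]]] := gE x; have [b [t [tJ ->]]] := gE y.
rewrite lieDl !lieDr !lieZl !lieZr lie_alt !scaler0 add0r memvD ?memvZ ?JY//.
by rewrite memvD ?Jlie// memvZ// lieC memvN JY.
Qed.

(** The predicate [w] stands for the wedge: its last hypothesis is the content of
    [edge_bracket_wedge], and on [V 1] the half-space makes [w] hold for each vector or its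
    opposite. *)
Lemma diamond_derived_sub s (V : nat -> {vspace g}) H (w : g -> Prop) :
  stratification s V -> type_diamond (V 1%N) -> lie_subalgebra H ->
  (V 1 <= H)%VS \/ (\dim (H :&: V 1%N)).+1 = \dim (V 1%N) ->
  (forall x, x \in V 1%N -> w x \/ w (- x)) ->
  (forall x y, w x -> y \in H -> lie y (lie y x) \in H -> lie y x \in H) ->
  (lie_prodv fullv fullv <= H)%VS.
Proof.
move=> strat dia Hlie VH wV wH.
case: VH => [VH|codim].
  (* With [V 1] inside [H], the elimination runs with [Y = 0]. *)
  apply: (derived_algebra_sub strat Hlie (mem0v _)) => [|k z zH zV].
    by rewrite (capv_idPr VH) addvSr.
  by elim: k => // k _; rewrite iterS /ad lie0l mem0v.
(* Both the condition and the conclusion are insensitive to the sign of [x]. *)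
have {}wH x y : x \in V 1%N -> y \in H -> lie y (lie y x) \in H ->
    lie y x \in H.
  move=> /wV[wx|wx] yH yyx; first exact: wH.
  by rewrite -memvN -lieNr; apply: wH => //; rewrite !lieNr memvN.
have [X [Xb XH]] := dia H Hlie codim.
have XV i : tnth X i \in V 1%N by apply: (basis_mem Xb); exact: mem_tnth.
have [i0 Yi0] : exists i0, tnth X i0 \notin H.
  apply/existsP; apply: contraT; rewrite negb_exists => /forallP XinH.
  suff VH : (V 1 <= H)%VS.
    by move: codim; rewrite (capv_idPr VH) => /eqP; rewrite eqn_leq ltnn.
  rewrite -(span_basis Xb); apply/span_subvP => x /tnthP[i ->].
  by have := XinH i; rewrite negbK.
set Y := tnth X i0 in Yi0.
have YV : Y \in V 1%N by exact: XV.
have Y0 : Y != 0 by apply: contraNneq Yi0 => ->; rewrite mem0v.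
have sV : (V 1 <= <[Y]> + H :&: V 1)%VS.
  suff /eqP -> : (<[Y]> + H :&: V 1)%VS == V 1%N by exact: subvv.
  rewrite eqEdim subv_add -memvE YV capvSr/=.
  rewrite dimv_disjoint_sum ?dim_vline ?Y0 ?add1n ?codim//.
  apply/eqP; rewrite -subv0; apply/subvP => y; rewrite memv_cap memv0.
  move=> /andP[/vlineP[a ->]]; rewrite memv_cap => /andP[+ _].
  have [->|a0] := eqVneq a 0; first by rewrite scale0r.
  by move/(memvZ a^-1); rewrite scalerK// (negPf Yi0).
have X2 i j : lie (tnth X i) (lie (tnth X i) (tnth X j)) \in H.
  by have [] := XH i j.
(* Write $X_j=aY+z$ with $z\in H$. Then $[z,Y]=[X_j,Y]$ and
   $\operatorname{ad}_z^2Y=\operatorname{ad}_{X_j}^2Y+a\operatorname{ad}_Y^2X_j$ is in [H], so [wH]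
   applies to [Y] and [z]. *)
have YX j : lie Y (tnth X j) \in H.
  have /(subvP sV)/memv_addP[_ /vlineP[a ->] [z + Xj]] := XV j.
  rewrite memv_cap => /andP[zH zV].
  have zE : z = tnth X j - a *: Y by rewrite Xj addrAC subrr add0r.
  have zY : lie z Y = lie (tnth X j) Y by rewrite Xj lieDl lieZl lie_alt scaler0 add0r.
  rewrite lieC memvN -zY; apply: wH => //.
  rewrite zY zE lieDl lieNl lieZl memvB ?memvZ ?X2//.
  by rewrite (lieC (tnth X j)) lieNr memvN X2.
(* From exponent 2 on, the second diamond condition lets [wH] raise the exponent by one. *)
have YkX j k : (0 < k)%N -> iter k (ad Y) (tnth X j) \in H.
  case: k => // -[_|k _]; first exact: YX.
  elim: k => [|k IH]; first exact: X2.
  rewrite iterS /ad lieC memvN; apply: wH => //.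
  by have [_] := XH i0 j; apply.
apply: (derived_algebra_sub strat Hlie YV sV) => -[//|k] z zH zV.
have [L Lz] : exists L : {vspace g}, forall x, x \in L <->
    iter k.+1 (ad Y) x \in H.
  apply: predicate_vspace => [|a x y xH yH].
    by elim: (k.+1) => [|m IH]; rewrite ?mem0v// iterSr /ad lie0r.
  suff -> : iter k.+1 (ad Y) (a *: x + y)
      = a *: iter k.+1 (ad Y) x + iter k.+1 (ad Y) y by rewrite memvD// memvZ.
  by elim: (k.+1) => // m IH; rewrite !iterS IH /ad lieDr lieZr.
apply/Lz; apply: subvP zV; rewrite -(span_basis Xb).
by apply/span_subvP => x /tnthP[i ->]; apply/Lz; exact: YkX.
Qed.

End LieAlgebra.

(** * Tangent wedge of a closed semigroup *)

Section TangentWedge.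
Variables (R : realType) (g : lieAlgType R).
Local Notation E := 'rV[R]_(dim g).
Variable M : E -> E -> E.

Hypothesis hM : exp_chart M.
Hypothesis Mlie : forall x y : g, v2r (lie x y) = linv_bracket M (v2r x) (v2r y).

Variable S : set E.
Hypothesis Sclosed : closed S.
Hypothesis S0 : S 0.
Hypothesis SM : forall y z, S y -> S z -> S (M y z).

Implicit Types (x y z b n : E) (H : {vspace g}).
Local Notation Ad := (chart_Ad M).
Local Notation br := (linv_bracket M).

Let brE x y : r2v (br x y) = lie (r2v x) (r2v y).
Proof. by rewrite -{1}[x]r2vK -{1}[y]r2vK -Mlie v2rK. Qed.

Let AdZ x t y : Ad x (t *: y) = t *: Ad x y.
Proof.
have := chart_Ad_linear hM x t y 0.
by rewrite (chart_Ad_0 hM) !addr0.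
Qed.

Let AdN x y : Ad x (- y) = - Ad x y.
Proof. by rewrite -scaleN1r AdZ scaleN1r. Qed.

(** The projection [p] along [H] kills every velocity, so each coordinate of [p] along the curve has
    zero derivative and is constant. *)
Lemma is_derive_mem_vspace H (c c' : R -> E) :
  (forall s : R, is_derive s 1 c (c' s)) -> (forall s, r2v (c' s) \in H) ->
  forall s, r2v (c s - c 0) \in H.
Proof.
move=> dc c'H s.
pose p z := v2r (r2v z - projv H (r2v z)).
have p_linear : linear p.
  move=> a y z; rewrite /p -[RHS]linearP; congr (v2r _).
  by rewrite !linearP/= scalerDr addrACA.
have p_mem z : r2v z \in H -> p z = 0.
  by move=> zH; rewrite /p projv_id// subrr linear0.
have p_coord z j : p z 0 j = \sum_i z 0 i * p (delta_mx 0 i) 0 j.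
  rewrite {1}(linear_rowE p_linear) summxE.
  by apply: eq_bigr => i _; rewrite mxE.
suff /eqP : p (c s) = p (c 0).
  rewrite -subr_eq0 -scaleN1r addrC -p_linear scaleN1r addrC => /eqP/(congr1 r2v).
  rewrite v2rK linear0 => /eqP; rewrite subr_eq0 => /eqP ->.
  exact: memv_proj.
apply/rowP => j; rewrite !p_coord.
pose F t := \sum_i c t 0 i * p (delta_mx 0 i) 0 j.
apply: (@is_derive_0_is_cst _ F s 0) => t.
have dF i := is_deriveM (is_derive_coord i (dc t))
               (is_derive_cst (p (delta_mx 0 i) 0 j) t (1 : R)).
have := is_derive_bigsum dF.
set d := (X in is_derive _ _ _ X); suff -> : d = p (c' t) 0 j.
  by rewrite p_mem// mxE.
rewrite p_coord; apply: eq_bigr => i _.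
by rewrite scaler0 add0r mulrC.
Qed.

(** The Lie wedge of the closed semigroup [S]; the edge is its largest linear subspace. *)
Definition wedge z := forall t, 0 <= t -> S (t *: z).

Definition edge z := wedge z /\ wedge (- z).

Lemma wedge_lim (u : nat -> E) z :
  (forall k, wedge (u k)) -> u @ \oo --> z -> wedge z.
Proof.
move=> wu uz t t0; apply: (@closed_cvg _ _ \oo _ (fun k => t *: u k) S Sclosed).
  by apply: nearW => k; exact: wu.
exact: cvgZl_tmp.
Qed.

Lemma wedgeZ a z : 0 <= a -> wedge z -> wedge (a *: z).
Proof. by move=> a0 wz t t0; rewrite scalerA; apply: wz; rewrite mulr_ge0. Qed.

Lemma S_pow k z : S z -> S (k%:R *: z).
Proof.
move=> Sz; rewrite -(chart_pow hM); elim: k => // k IH.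
by rewrite iterS; exact: SM.
Qed.

Lemma wedgeD x y : wedge x -> wedge y -> wedge (x + y).
Proof.
move=> wx wy t t0; rewrite scalerDr.
apply: (@closed_cvg _ _ \oo _ _ S Sclosed _ _ (@cvg_chart_trotter _ _ _ hM (t *: x) (t *: y))).
apply: nearW => k; apply/S_pow/SM; rewrite scalerA.
  by apply: wx; rewrite mulr_ge0// invr_ge0.
by apply: wy; rewrite mulr_ge0// invr_ge0.
Qed.

Lemma wedge0 : wedge 0.
Proof. by move=> t _; rewrite scaler0. Qed.

Lemma edgeN z : edge z -> edge (- z).
Proof. by rewrite /edge opprK => -[]. Qed.

Lemma edgeD x y : edge x -> edge y -> edge (x + y).
Proof. by move=> [? ?] [? ?]; split; rewrite ?opprD; exact: wedgeD. Qed.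

Lemma edgeZ a z : edge z -> edge (a *: z).
Proof.
move=> [wz wNz]; have [a0|/ltW a0] := leP 0 a.
  by split; rewrite -?scalerN; exact: wedgeZ.
split; last by rewrite -scaleNr; apply: wedgeZ; rewrite ?oppr_ge0.
have -> : a *: z = (- a) *: (- z) by rewrite scaleNr scalerN opprK.
by apply: wedgeZ; rewrite ?oppr_ge0.
Qed.

Lemma edge_S t z : edge z -> S (t *: z).
Proof.
by move=> /(edgeZ t)[/(_ 1 ler01)]; rewrite scale1r.
Qed.

Lemma edge_lim (u : nat -> E) z :
  (forall k, edge (u k)) -> u @ \oo --> z -> edge z.
Proof.
move=> eu uz; split; first by apply: wedge_lim uz => k; have [] := eu k.
by apply: wedge_lim (cvgN uz) => k; have [] := eu k.
Qed.

Lemma edge_vspace : exists H, forall z, r2v z \in H <-> edge z.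
Proof.
have [|a x y ex ey|H HE] := @predicate_vspace _ g (fun v => edge (v2r v)).
- by rewrite linear0; split; rewrite ?oppr0; exact: wedge0.
- by rewrite linearP; apply: edgeD => //; exact: edgeZ.
by exists H => z; rewrite HE r2vK.
Qed.

Lemma wedge_Ad x y : edge x -> wedge y -> wedge (Ad x y).
Proof.
move=> ex wy t t0; rewrite -AdZ; apply: SM; last first.
  by have := edge_S (- 1) ex; rewrite scaleN1r.
by apply: SM; [have := edge_S 1 ex; rewrite scale1r|exact: wy].
Qed.

Lemma edge_Ad x y : edge x -> edge y -> edge (Ad x y).
Proof. by move=> ex [wy wNy]; split; rewrite -?AdN; exact: wedge_Ad. Qed.

(** The bracket is the velocity at 0 of [Ad (s *: x) y - y], a curve in the edge, and the edge is
    closed. *)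
Lemma edge_bracket x y : edge x -> edge y -> edge (br x y).
Proof.
move=> ex ey.
have dB : is_derive (0 : R) 1 (fun s => Ad (s *: x) y - y) (br x y).
  rewrite -[br x y]subr0.
  exact: is_deriveB (is_derive_chart_Ad0 hM x y) (is_derive_cst y (0 : R) 1).
have := cvg_derive_seq _ dB.
rewrite scale0r (chart_Ad0 hM) subrr => /(_ erefl); apply: edge_lim => k.
apply/edgeZ/edgeD; last exact: edgeN.
by apply: edge_Ad => //; exact: edgeZ.
Qed.

(* If [ad y ^ 2 x] lies in the edge, then [Ad (exp (s y)) x] and            *)
(* [x + s [y, x]] agree modulo the edge; divide by [s -> +oo, -oo].          *)
Lemma edge_bracket_wedge x y : wedge x -> edge y -> edge (br y (br y x)) ->
  edge (br y x).
Proof.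
move=> wx ey eyyx; have [H HE] := edge_vspace.
have eZ s : edge (s *: y) by exact: edgeZ.
(* A Taylor expansion modulo the edge, by integrating twice: the velocity here is a conjugate of
   [br y (br y x)], and the velocity in [eu] is the element found here. *)
have eAd s : edge (Ad (s *: y) (br y x) - br y x).
  apply/HE; rewrite -{2}[br y x](chart_Ad0 hM) -[in Ad 0](scale0r y).
  apply: is_derive_mem_vspace (is_derive_chart_Adr hM y (br y x)) _ s.
  by move=> t; apply/HE/edge_Ad.
have eu s : edge (Ad (s *: y) x - s *: br y x - x).
  apply/HE.
  have dB t := is_deriveB (is_derive_chart_Adr hM y x t)
                 (is_derive_scale (br y x) t).
  have := is_derive_mem_vspace dB _ s; rewrite !fctE/= !scale0r subr0.
  rewrite (chart_Ad0 hM); apply => t; exact/HE/eAd.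
have wu s : wedge (x + s *: br y x).
  have -> : x + s *: br y x
      = Ad (s *: y) x + - (Ad (s *: y) x - s *: br y x - x).
    by rewrite !opprD !opprK !addrA subrr add0r addrC.
  by apply: wedgeD; [exact: wedge_Ad|have [] := edgeN (eu s)].
have wlim (a : R) : `|a| = 1 -> wedge (a *: br y x).
  move=> a1.
  (* The point of the line at $s=(k+1)a$, rescaled by $1/(k+1)$. *)
  apply: (@wedge_lim (fun k => k.+1%:R^-1 *: (x + (k.+1%:R * a) *: br y x))).
    by move=> k; apply: wedgeZ => //; rewrite invr_ge0.
  suff: (k.+1%:R^-1 *: x + a *: br y x) @[k --> \oo] --> 0 *: x + a *: br y x.
    rewrite scale0r add0r; apply: cvg_trans; apply: near_eq_cvg.
    apply: nearW => k /=.
    by rewrite [RHS]scalerDr scalerA mulrA mulVf ?mul1r// pnatr_eq0.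
  apply: cvgD; last exact: cvg_cst.
  by apply: cvgZr_tmp; exact: cvg_harmonic.
split; first by have := wlim 1 (normr1 R); rewrite scale1r.
by have := wlim (- 1) (normrN1 R); rewrite scaleN1r.
Qed.

(** * Group commutators from the derived algebra *)

Hypothesis edge_derived : forall z,
  r2v z \in lie_prodv (fullv : {vspace g}) fullv -> edge z.

Local Notation derived := (lie_prodv (fullv : {vspace g}) fullv).

(** The group of units of [S]. *)
Let T z := S z /\ S (- z).

Let TM y z : T y -> T z -> T (M y z).
Proof.
move=> [Sy SNy] [Sz SNz].
by split; rewrite ?(chart_opp_mul hM); exact: SM.
Qed.

Lemma chart_Ad_sub_derived b y : r2v (Ad b y - y) \in derived.
Proof.
rewrite -{2}[y](chart_Ad0 hM) -[in Ad 0](scale0r b).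
rewrite -{1}[b]scale1r.
apply: is_derive_mem_vspace (is_derive_chart_Adl hM b y) _ 1.
by move=> t; rewrite brE mem_lie_prodv ?memvf.
Qed.

(* By Trotter, [exp (b + n) exp (- b)] is a limit of products of conjugates  *)
(* of [exp (n / k)].                                                        *)
Lemma chart_shift_mem b n : r2v n \in derived ->
  S (M (b + n) (- b)) /\ S (- M (b + n) (- b)).
Proof.
move=> nN.
(* Requiring all conjugates to be units makes [T'] stable under conjugation as well as products. *)
pose T' z := forall b, T (Ad b z).
have T'M y z : T' y -> T' z -> T' (M y z).
  by move=> Ty Tz a; rewrite (chart_Ad_mul hM); exact: TM.
have T'Ad a z : T' z -> T' (Ad a z).
  by move=> Tz c; rewrite -(chart_Ad_comp hM).
have T'0 : T' 0 by move=> a; rewrite (chart_Ad_0 hM); split; rewrite ?oppr0.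
have T'N z : r2v z \in derived -> T' z.
  move=> zN a; suff /edge_derived ez : r2v (Ad a z) \in derived.
    split; first by have := edge_S 1 ez; rewrite scale1r.
    by have := edge_S (- 1) ez; rewrite scaleN1r.
  have -> : Ad a z = (Ad a z - z) + z by rewrite subrK.
  by rewrite linearD memvD// chart_Ad_sub_derived.
(* Induction through $(e^ce^m)^{k+1}e^{-(k+1)c}=e^c\,(e^m\,(e^ce^m)^ke^{-kc})\,e^{-c}$. *)
have T'iter c m k : r2v m \in derived ->
    T' (M (iter k (M (M c m)) 0) (- (k%:R *: c))).
  move=> mN; elim: k => [|k IH].
    by rewrite scale0r oppr0 /= (chart_mul0l hM).
  set P := iter k _ 0 in IH.
  have -> : M (iter k.+1 (M (M c m)) 0) (- (k.+1%:R *: c))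
      = Ad c (M m (M P (- (k%:R *: c)))).
    rewrite iterS -/P /chart_Ad -natr1 -!scalerN -{3}[- c]scale1r.
    by rewrite -(chart_mulZ hM) scale1r !(chart_mulA hM).
  by apply/T'Ad/T'M => //; exact: T'N.
pose u k := M (k.+1%:R *: M (k.+1%:R^-1 *: b) (k.+1%:R^-1 *: n)) (- b).
have ucvg : u @ \oo --> M (b + n) (- b).
  exact: (cvg_comp _ _ (@cvg_chart_trotter _ _ _ hM b n)
    (differentiable_continuous (chart_mul_differentiablel hM _ _))).
have Tu k : T (u k).
  have e : b = k.+1%:R *: (k.+1%:R^-1 *: b) by rewrite scalerKV// pnatr_eq0.
  rewrite /u -(chart_pow hM) [X in M _ (- X)]e.
  rewrite -[M _ _](chart_Ad0 hM); apply: T'iter.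
  by rewrite linearZ memvZ.
split; first by apply: (@closed_cvg _ _ \oo _ u S Sclosed) => //;
  apply: nearW => k; have [] := Tu k.
apply: (@closed_cvg _ _ \oo _ (fun k => - u k) S Sclosed); last exact: cvgN.
by apply: nearW => k; have [] := Tu k.
Qed.

Lemma chart_commutator_mem a b :
  S (M (Ad a b) (- b)) /\ S (- M (Ad a b) (- b)).
Proof.
have -> : Ad a b = b + (Ad a b - b) by rewrite addrC subrK.
exact/chart_shift_mem/chart_Ad_sub_derived.
Qed.

End TangentWedge.

(** * Back to the group, and conclusion *)

Section ExpLieGroup.
Variables (R : realType) (g : lieAlgType R) (G : expLieGroup g).
Local Notation E := 'rV[R]_(dim g).
Local Notation lexp := (@lexp R g G).
Local Notation llog := (@llog R g G).
Local Notation M := (@lmul_chart R g G).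

Lemma lexp0 : lexp 0 = 1%g.
Proof.
have := lexpD G 0 0 0; rewrite addr0 scale0r => e.
by apply: (mulgI (lexp 0)); rewrite -e mulg1.
Qed.

Lemma lexpM (x y : E) : lexp (r2v (M x y)) = (lexp (r2v x) * lexp (r2v y))%g.
Proof. by rewrite /lmul_chart v2rK llogK. Qed.

Lemma lexp_inj : injective (fun z : E => lexp (r2v z)).
Proof. by move=> x y /(can_inj (@lexpK _ _ G))/r2v_inj. Qed.

Lemma lexpN (x : g) : lexp (- x) = (lexp x)^-1%g.
Proof.
apply: (mulgI (lexp x)); rewrite mulgV -lexp0.
by have := lexpD G 1 (- 1) x; rewrite subrr scale0r scale1r scaleN1r.
Qed.

Lemma lmul_exp_chart : exp_chart M.
Proof.
split; first exact: lmul_smooth.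
- by move=> x y z; apply: lexp_inj; rewrite !lexpM mulgA.
- by move=> z; apply: lexp_inj; rewrite lexpM linear0 lexp0 mul1g.
- by move=> a b z; apply: lexp_inj; rewrite lexpM !linearZ -lexpD.
Qed.

Lemma mulg_continuous_l (a : G) : continuous (fun b : G => a * b)%g.
Proof.
have -> : (fun b : G => a * b)%g =
    (fun z => lexp (r2v z)) \o (fun z => M (v2r (llog a)) z)
      \o (fun b => v2r (llog b)).
  by apply/funext => b /=; rewrite lexpM !v2rK !llogK.
move=> b; apply: continuous_comp; first exact: llog_continuous.
apply: continuous_comp; last exact: lexp_continuous.
exact/differentiable_continuous/(chart_mul_differentiabler lmul_exp_chart).
Qed.

Lemma mulg_continuous_r (b : G) : continuous (fun a : G => a * b)%g.
Proof.
have -> : (fun a : G => a * b)%g =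
    (fun z => lexp (r2v z)) \o (fun z => M z (v2r (llog b)))
      \o (fun a => v2r (llog a)).
  by apply/funext => a /=; rewrite lexpM !v2rK !llogK.
move=> a; apply: continuous_comp; first exact: llog_continuous.
apply: continuous_comp; last exact: lexp_continuous.
exact/differentiable_continuous/(chart_mul_differentiablel lmul_exp_chart).
Qed.

(** Continuity in each factor separately suffices: approximate first [b], then [a], by elements of
    [A]. *)
Lemma closure_subsemigroup (A : set G) :
  is_subsemigroup A -> is_subsemigroup (closure A).
Proof.
move=> AM.
have cl (f : G -> G) B : continuous f -> (forall a, B a -> closure A (f a)) ->
    forall a, closure B a -> closure A (f a).
  move=> fc fB; rewrite closureE; apply: smallest_sub => //.
  by apply: preimage_closed; [move=> ? _; exact: fc|exact: closed_closure].
move=> a b clAa clAb; move: b clAb.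
apply: (cl _ _ (@mulg_continuous_l a)) => b Ab.
move: a clAa; apply: (cl _ _ (@mulg_continuous_r b)) => a Aa.
exact/subset_closure/AM.
Qed.

Lemma semigenerating_halfspace (s : nat) (V : nat -> {vspace g})
    (l : 'Hom(subvs_of (V 1%N), R^o)) :
  stratification s V -> type_diamond (V 1%N) ->
  semigenerating G (vsval @` [set u | 0 <= (l u : R)]).
Proof.
move=> strat dia; rewrite /semigenerating; set W := vsval @` _; set A := semigroup_generated _.
have hM := lmul_exp_chart.
have AM : is_subsemigroup A.
  by move=> a b Aa Ab B BP; apply: BP.1; [exact: Aa|exact: Ab].
have clM := closure_subsemigroup AM.
have WA x : W x -> closure A (lexp x).
  by move=> Wx; apply: subset_closure => B [_]; apply; exists x.
have W0 : W 0 by exists 0; rewrite /= ?linear0.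
pose S := (fun z => lexp (r2v z)) @^-1` closure A.
have Sclosed : closed S.
  by apply: preimage_closed; [move=> ? _; exact: lexp_continuous|exact: closed_closure].
have S0 : S 0 by rewrite /S/= linear0; exact: WA.
have SM y z : S y -> S z -> S (M y z).
  by move=> Sy Sz; rewrite /S/= lexpM; exact: clM.
have WS u : 0 <= l u :> R -> wedge S (v2r (vsval u)).
  move=> lu t t0; rewrite /S/= linearZ/= v2rK; apply: WA.
  exists (t *: u); last by rewrite linearZ.
  by rewrite /= linearZ; exact: mulr_ge0.
have WE u : l u = 0 -> edge S (v2r (vsval u)).
  by move=> lu; split; [|rewrite -!linearN]; apply: WS; rewrite ?linearN/= lu ?oppr0.
have [H HE] := edge_vspace hM Sclosed S0 SM.
have HE' x : x \in H <-> edge S (v2r x) by rewrite -HE v2rK.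
have Hlie : lie_subalgebra H.
  move=> x y /HE' ex /HE' ey; apply/HE'; rewrite (lexp_lie G).
  exact: edge_bracket.
have V1P x : x \in V 1%N -> exists u : subvs_of (V 1%N), x = vsval u.
  by move=> xV; exists (Subvs xV).
(* The kernel of [l] lies in [H]; if some [x] of [V 1] does not, then [l] is non-zero at [x], and
   [x] together with the kernel spans [V 1]. *)
have VH : (V 1 <= H)%VS \/ (\dim (H :&: V 1%N)).+1 = \dim (V 1%N).
  have [VH|/subvPn[x /V1P[u ux] xH]] := boolP (V 1 <= H)%VS; [by left|right].
  have lu0 : l u != 0.
    by apply: contraNneq xH => lu; apply/HE'; rewrite ux; exact: WE.
  apply/eqP; rewrite eqn_leq; apply/andP; split.
    rewrite (ltn_leqif (dimv_leqif_sup (capvSr H (V 1%N)))) subv_cap subvv andbT.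
    by apply: contra xH => /subvP; apply; rewrite ux; exact: subvsP.
  have : (V 1 <= H :&: V 1 + <[x]>)%VS.
    apply/subvP => y /V1P[v ->].
    rewrite -(subrK ((l v / l u) *: vsval u) (vsval v)) memv_add//; last first.
      by apply/vlineP; exists (l v / l u); rewrite ux.
    rewrite -linearZ -linearB memv_cap subvsP andbT; apply/HE'/WE.
    by rewrite linearB linearZ/= /GRing.scale/= divfK// subrr.
  move=> /dimvS/leq_trans; apply; rewrite (leq_trans (dimv_add_leqif _ _))//.
  by rewrite dim_vline -addn1 leq_add2l leq_b1.
have derH : (lie_prodv fullv fullv <= H)%VS.
  apply: (diamond_derived_sub (w := fun x => wedge S (v2r x)) strat dia Hlie VH).
    move=> _ /V1P[u ->]; have [lu|/ltW lu] := leP 0 (l u : R).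
      by left; exact: WS.
    by right; rewrite -linearN; apply: WS; rewrite linearN oppr_ge0.
  move=> x y wx /HE' ey; rewrite HE' !(lexp_lie G) => eyyx; apply/HE'.
  by rewrite (lexp_lie G); exact: edge_bracket_wedge eyyx.
have edge_derived z : r2v z \in lie_prodv (fullv : {vspace g}) fullv -> edge S z.
  by move=> /(subvP derH)/HE.
(* [T] is a subgroup, so only single commutators need checking. *)
pose T (a : G) := closure A a /\ closure A a^-1%g.
suff TC : commutator_subgroup G `<=` T by move=> a /TC[].
apply: smallest_sub.
  split=> [|a b [Aa ANa] [Ab ANb]|a [Aa ANa]]; rewrite /T ?invg1 ?invgK//.
    by rewrite -lexp0; split; exact: WA.
  by rewrite invgM; split; exact: clM.
move=> _ [a [b ->]].
(* Inverses appear because [commg a b] is $a^{-1}b^{-1}ab$. *)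
pose x := v2r (llog a^-1%g); pose y := v2r (llog b^-1%g).
have xE : lexp (r2v x) = a^-1%g by rewrite v2rK llogK.
have yE : lexp (r2v y) = b^-1%g by rewrite v2rK llogK.
have [] := chart_commutator_mem hM (lexp_lie G) Sclosed S0 SM edge_derived x y.
rewrite /S/= linearN lexpN /chart_Ad !lexpM !linearN !lexpN xE yE !invgK.
by rewrite /T /commg /conjg !mulgA.
Qed.

End ExpLieGroup.

Local Close Scope ring_scope.
Local Close Scope classical_set_scope.

Theorem theorem1p5 (R : realType) (g : lieAlgType R)
    (s : nat) (V : nat -> {vspace g}) :
  stratification s V -> type_diamond (V 1) -> semigenerated (V 1).
Proof.
move=> strat dia G _ [l _ ->].
exact: semigenerating_halfspace strat dia.
Qed.
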